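(* Let $\lambda\vdash n$ (with $n\ge2$) be a hook partition, i.e. $\lambda=(m,1,\dots,1)$, which is not of the form $(n)$, $(1^n)$ or $(2,1)$. Then the representation $\rho_\lambda:C_n\to GL(S^\lambda_{\mathsf{Sch}})$ factors over $S_{n-1}$ as $$\rho_\lambda=\eta\circ\pi_{n-1},$$ where $\pi_{n-1}:C_n\to S_{n-1}$ and $\eta:S_{n-1}\to GL(S^\lambda_{\mathsf{Sch}})$ are the homomorphisms defined in the context.
   Context: All representations are over $\mathbb{C}$. Cactus group. For $J=[a,b]=\{a,\dots,b\}\subseteq[1,n]$ let $w_J\in S_n$ be the permutation with $a+i\mapsto b-i$ for $0\le i\le b-a$, fixing all points outside $J$. For $n\ge2$ the cactus group $C_n$ is generated by $c_J$, $J\in\{[a,b] : 1\le a<b\le n\}$, subject to $c_J^2=1$; $c_Jc_K=c_Kc_J$ if $J\cap K=\emptyset$; and $c_Jc_K=c_{w_J(K)}c_J$ if $K\subseteq J$. The surjective homomorphism $\pi_{n-1}:C_n\to S_{n-1}$ is given by $c_{[a,b]}\mapsto w_{[a,b-1]}$ if $b-a>1$ and $c_{[a,b]}\mapsto1$ otherwise. Schützenberger involutions. $\mathrm{SYT}(\lambda)$ is the set of standard Young tableaux of shape $\lambda$ with entries $1,\dots,n$. The promotion $\partial$ of a standard tableau with $m$ boxes is: replace the box labelled $1$ by an empty (dummy) box; repeatedly swap the dummy box with the smaller of its neighbours immediately to the east and to the south (or with the only such neighbour) until it has neither; subtract $1$ from all remaining labels; label the dummy box $m$. For $T\in\mathrm{SYT}(\lambda)$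 let $T|_{[1,k]}$ be the part of $T$ with entries in $[1,k]$, and let $\partial_k$ apply $\partial$ to $T|_{[1,k]}$, leaving all boxes with entries $>k$ unchanged ($\partial_1$ is the identity). Set $\xi_{[1,k]}=\partial_1\circ\partial_2\circ\cdots\circ\partial_k$ for $2\le k\le n$, and $\xi_{[a,b]}=\xi_{[1,b]}\circ\xi_{[1,b-a+1]}\circ\xi_{[1,b]}$ for $1\le a<b\le n$. The assignment $c_J\mapsto\xi_J$ defines an action of $C_n$ on $\mathrm{SYT}(\lambda)$. Schützenberger module. Let $\{b_T : T\in\mathrm{SYT}(\lambda)\}$ be the Kazhdan–Lusztig basis of the Specht module $S^\lambda$ (a basis indexed by standard tableaux). $(\rho_\lambda,S^\lambda_{\mathsf{Sch}})$ is the vector space $S^\lambda$ with the $C_n$-action $\rho_\lambda(c_J)b_T=b_{\xi_J(T)}$. The map $\eta$. For $1\le k\le n-1$ let $t_k$ act on $\mathrm{SYT}(\lambda)$ by swapping the entries $k$ and $k+1$ of $T$ if the boxes containing them are not adjacent (horizontally or vertically), and by $t_k\cdot T=T$ otherwise. Let $\psi(t_k)\in GL(S^\lambda_{\mathsf{Sch}})$ be given by $\psi(t_k)b_T=b_{t_k\cdot T}$. For a hook shape $\lambda$, $\eta:S_{n-1}\to GL(S^\lambda_{\mathsf{Sch}})$ is the (well-defined) group homomorphism with $\eta(s_k)=\psi(t_{k+1})$ for $1\le k\le n-2$, where $s_k\in S_{n-1}$ is the transposition swapping $k$ and $k+1$. *)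

(* Defs.v *)
From HB Require Import structures.
From mathcomp Require Import all_boot all_order all_fingroup all_algebra zify.
From mathcomp Require Import boolp reals complex.

Set Implicit Arguments.
Unset Strict Implicit.
Unset Printing Implicit Defensive.

Local Open Scope group_scope.
Local Open Scope quotient_scope.

(* A letter (x, true) stands for x and (x, false) for x^-1. *)
Definition word (X : Type) := seq (X * bool).

Inductive pres_eq (X : Type) (R : word X -> word X -> Prop) :
    word X -> word X -> Prop :=
| PresRel u v of R u v : pres_eq R u v
| PresCancel x s : pres_eq R [:: (x, s); (x, ~~ s)] [::]
| PresCat u u' v v' of pres_eq R u u' & pres_eq R v v' :
    pres_eq R (u ++ v) (u' ++ v')
| PresRefl u : pres_eq R u u
| PresSym u v of pres_eq R u v : pres_eq R v u
| PresTrans u v w of pres_eq R u v & pres_eq R v w : pres_eq R u w.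

Local Notation repr := generic_quotient.repr.

Section PresentedGroup.
Variables (X : choiceType) (R : word X -> word X -> Prop).

Definition pres_eqb (u v : word X) : bool := `[< pres_eq R u v >].

Lemma pres_eqb_refl : reflexive pres_eqb.
Proof. by move=> u; apply/asboolP; exact: PresRefl. Qed.

Lemma pres_eqb_sym : symmetric pres_eqb.
Proof. by move=> u v; apply/asboolP/asboolP; exact: PresSym. Qed.

Lemma pres_eqb_trans : transitive pres_eqb.
Proof.
by move=> v u w /asboolP uv /asboolP vw; apply/asboolP; exact: PresTrans uv vw.
Qed.

Canonical pres_equiv := EquivRel pres_eqb
  pres_eqb_refl pres_eqb_sym pres_eqb_trans.

Definition pres_group := {eq_quot pres_equiv}.
HB.instance Definition _ := Choice.on pres_group.
HB.instance Definition _ := EqQuotient.on pres_group.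

Definition pres_class (u : word X) : pres_group := \pi_pres_group u.

Lemma pres_classP u v : pres_eq R u v <-> pres_class u = pres_class v.
Proof.
split=> [uv|/eqmodP /asboolP //].
by apply/eqmodP; apply/asboolP.
Qed.

Lemma pres_class_repr (g : pres_group) : pres_class (repr g) = g.
Proof. exact: reprK. Qed.

Lemma repr_pres_class u : pres_eq R (repr (pres_class u)) u.
Proof. by apply/pres_classP; rewrite pres_class_repr. Qed.

Definition word_inv (u : word X) : word X :=
  rev [seq (l.1, ~~ l.2) | l <- u].

Definition pres_one : pres_group := pres_class [::].
Definition pres_mul (g h : pres_group) := pres_class (repr g ++ repr h).
Definition pres_inv (g : pres_group) := pres_class (word_inv (repr g)).

Lemma pres_mulE u v : pres_mul (pres_class u) (pres_class v) = pres_class (u ++ v).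
Proof. by apply/pres_classP; apply: PresCat; exact: repr_pres_class. Qed.

Lemma pres_mulA : associative pres_mul.
Proof.
move=> g h k; rewrite -(pres_class_repr g) -(pres_class_repr h).
by rewrite -(pres_class_repr k) !pres_mulE catA.
Qed.

Lemma pres_mul1g : left_id pres_one pres_mul.
Proof. by move=> g; rewrite -(pres_class_repr g) pres_mulE. Qed.

Lemma pres_mulg1 : right_id pres_one pres_mul.
Proof. by move=> g; rewrite -(pres_class_repr g) pres_mulE cats0. Qed.

Lemma word_invK : involutive word_inv.
Proof.
move=> u; rewrite /word_inv map_rev revK -map_comp -[RHS]map_id.
by apply: eq_map => -[x s] /=; rewrite negbK.
Qed.

Lemma pres_eq_mulV u : pres_eq R (u ++ word_inv u) [::].
Proof.
elim: u => [|[x s] u IHu]; first exact: PresRefl.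
rewrite /word_inv /= rev_cons -cats1 catA -cat_rcons cats0 -/(word_inv u).
rewrite -cats1 -cat1s.
apply: PresTrans (PresCancel R x s).
apply: (@PresCat _ _ [:: (x, s)] [:: (x, s)] (_ ++ _) [:: (x, ~~ s)]).
  exact: PresRefl.
apply: (@PresCat _ _ _ [::] _ [:: (x, ~~ s)]); last exact: PresRefl.
exact: IHu.
Qed.

Lemma pres_mulgV : right_inverse pres_one pres_inv pres_mul.
Proof.
move=> g; rewrite -{1}(pres_class_repr g) /pres_inv pres_mulE.
by apply/pres_classP; exact: pres_eq_mulV.
Qed.

Lemma pres_mulVg : left_inverse pres_one pres_inv pres_mul.
Proof.
move=> g; rewrite -{2}(pres_class_repr g) /pres_inv pres_mulE.
apply/pres_classP; rewrite -{2}[repr g]word_invK; exact: pres_eq_mulV.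
Qed.

HB.instance Definition _ := isGroup.Build pres_group
  pres_mulA pres_mul1g pres_mulg1 pres_mulVg pres_mulgV.

Definition pres_gen (x : X) : pres_group := pres_class [:: (x, true)].

Section Lift.
Variables (H : groupType) (f : X -> H).

Definition word_eval (u : word X) : H :=
  \prod_(l <- u) (if l.2 then f l.1 else (f l.1)^-1).

Hypothesis fR : forall u v, R u v -> word_eval u = word_eval v.

Lemma word_eval_cat u v : word_eval (u ++ v) = word_eval u * word_eval v.
Proof. by rewrite /word_eval big_cat. Qed.

Lemma pres_eq_eval u v : pres_eq R u v -> word_eval u = word_eval v.
Proof.
elim=> {u v} [u v /fR // | x s | u u' v v' _ uu' _ vv' | // | // | u v w _ -> _ -> //].
  by rewrite /word_eval !big_cons big_nil; case: s; rewrite /= mulg1 ?mulgV ?mulVg.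
by rewrite !word_eval_cat uu' vv'.
Qed.

Definition pres_lift (g : pres_group) : H := word_eval (repr g).

Lemma pres_liftM : {morph pres_lift : g h / g * h}.
Proof.
move=> g h; rewrite /pres_lift -word_eval_cat; apply: pres_eq_eval.
exact: repr_pres_class.
Qed.

Lemma pres_lift1 : pres_lift 1 = 1.
Proof.
rewrite /pres_lift (pres_eq_eval (repr_pres_class [::])).
by rewrite /word_eval big_nil.
Qed.

Lemma pres_lift_gen x : pres_lift (pres_gen x) = f x.
Proof.
rewrite /pres_lift (pres_eq_eval (repr_pres_class _)).
by rewrite /word_eval big_cons big_nil mulg1.
Qed.

End Lift.
End PresentedGroup.

(* The point k of [1, n] is represented by the ordinal k.-1 : 'I_n.  The
   permutation reversal n a b is w_[a, b] in S_n; the guard makes it the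
   identity when [a, b] is not an interval of [1, n], so that insubd never
   returns its default. *)
Definition reversal_fun n a b (i : 'I_n) : 'I_n :=
  if [&& 0 < a, a <= i.+1 <= b & b <= n] then insubd i (a + b - i.+1).-1 else i.

Lemma reversal_funE n a b (i : 'I_n) : reversal_fun a b i =
  (if [&& 0 < a, a <= i.+1 <= b & b <= n] then (a + b - i.+1).-1 else i) :> nat.
Proof.
rewrite /reversal_fun; case: ifP => // H; rewrite val_insubd ifT //.
by move: H (ltn_ord i); lia.
Qed.

Lemma reversal_funP n a b (i : 'I_n) :
  if [&& 0 < a, a <= i.+1 <= b & b <= n]
  then (reversal_fun a b i + i).+2 = a + b else reversal_fun a b i = i :> nat.
Proof.
rewrite reversal_funE; move: (ltn_ord i).
by case: (boolP [&& 0 < a, a <= i.+1 <= b & b <= n]); lia.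
Qed.

Lemma reversal_funK n a b : involutive (@reversal_fun n a b).
Proof.
move=> i; apply: val_inj => /=; rewrite !reversal_funE.
case: (boolP [&& 0 < a, a <= i.+1 <= b & b <= n]) => [iab|/negPf iab].
  by case: ifP; move: iab (ltn_ord i); lia.
by rewrite iab.
Qed.

Definition reversal n a b : 'S_n := perm (can_inj (@reversal_funK n a b)).

Definition cactus_gen n := {J : nat * nat | (0 < J.1 < J.2) && (J.2 <= n)}.
HB.instance Definition _ n := Choice.on (cactus_gen n).

Definition lo n (J : cactus_gen n) : nat := (val J).1.
Definition hi n (J : cactus_gen n) : nat := (val J).2.

Definition points n (J : cactus_gen n) : {set 'I_n} :=
  [set i : 'I_n | lo J <= i.+1 <= hi J].

Definition w_ n (J : cactus_gen n) : 'S_n := reversal n (lo J) (hi J).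

Inductive cactus_rel n : word (cactus_gen n) -> word (cactus_gen n) -> Prop :=
| CactusInvol J : cactus_rel [:: (J, true); (J, true)] [::]
| CactusDisj J K of [disjoint points J & points K] :
    cactus_rel [:: (J, true); (K, true)] [:: (K, true); (J, true)]
| CactusNest J K L of points K \subset points J & points L = w_ J @: points K :
    cactus_rel [:: (J, true); (K, true)] [:: (L, true); (J, true)].

Definition cactus n := pres_group (@cactus_rel n).
HB.instance Definition _ n := Group.on (cactus n).

Definition cactus_c n (J : cactus_gen n) : cactus n := pres_gen (@cactus_rel n) J.

(* Permutations are multiplied left to right here.  Since every w_J is an
   involution, the formula on the generators extends to a homomorphism for
   either convention, and the two homomorphisms differ by inversion. *)
Definition cactus_pi_gen n (J : cactus_gen n) : 'S_n.-1 :=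
  if 1 < hi J - lo J then reversal n.-1 (lo J) (hi J).-1 else 1.

Lemma mem_points n (J : cactus_gen n) (i : 'I_n) :
  (i \in points J) = (lo J <= i.+1 <= hi J).
Proof. by rewrite inE. Qed.

Lemma cactus_genP n (J : cactus_gen n) :
  [/\ 0 < lo J, lo J < hi J & hi J <= n].
Proof. by case: J => J; rewrite /lo /hi /= => /andP[/andP[-> ->] ->]. Qed.

Lemma points_subset n (J K : cactus_gen n) : points K \subset points J ->
  lo J <= lo K /\ hi K <= hi J.
Proof.
have [K0 K1 K2] := cactus_genP K; move=> /subsetP sKJ.
have a_lt : (lo K).-1 < n by lia.
have b_lt : (hi K).-1 < n by lia.
move: (sKJ (Ordinal a_lt)) (sKJ (Ordinal b_lt)); rewrite !mem_points /=.
by rewrite !prednK //; lia.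
Qed.

Lemma reversal_disjoint n a b c d : b < c \/ d < a ->
  reversal n a b * reversal n c d = reversal n c d * reversal n a b.
Proof.
move=> bc; apply/permP => i; apply: val_inj.
rewrite !permM !permE /=.
have := reversal_funP a b i.
have := reversal_funP c d (reversal_fun a b i).
have := reversal_funP c d i.
have := reversal_funP a b (reversal_fun c d i).
by move: (ltn_ord i); do 4![case: ifP => ?]; lia.
Qed.

Lemma reversal_nested n a b c d : a <= c -> d <= b -> 0 < a -> b <= n -> c <= d ->
  reversal n a b * reversal n c d =
  reversal n (a + b - d) (a + b - c) * reversal n a b.
Proof.
move=> ac db a0 bn cd; apply/permP => i; apply: val_inj.
rewrite !permM !permE /=.
have := reversal_funP a b i.
have := reversal_funP c d (reversal_fun a b i).
have := reversal_funP (a + b - d) (a + b - c) i.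
have := reversal_funP a b (reversal_fun (a + b - d) (a + b - c) i).
by move: (ltn_ord i); do 4![case: ifP => ?]; lia.
Qed.

Lemma reversalK n a b : reversal n a b * reversal n a b = 1.
Proof. by apply/permP => i; rewrite permM perm1 !permE /= reversal_funK. Qed.

Lemma points_w n (J K L : cactus_gen n) : points K \subset points J ->
  points L = w_ J @: points K ->
  lo L = lo J + hi J - hi K /\
  hi L = lo J + hi J - lo K.
Proof.
move=> sKJ eL; have [JK1 JK2] := points_subset sKJ.
have [J0 J1 J2] := cactus_genP J; have [K0 K1 K2] := cactus_genP K.
have [L0 L1 L2] := cactus_genP L.
have memL (i : 'I_n) : (i \in points L) = (w_ J i \in points K).
  rewrite eL; apply/imsetP/idP => [[j jK ->]|wiK].
    by rewrite -permM reversalK perm1.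
  by exists (w_ J i); rewrite // -permM reversalK perm1.
have {}memL p : 0 < p <= n -> (lo L <= p <= hi L) =
    (lo J + hi J - hi K <= p <= lo J + hi J - lo K).
  case: p => // p /= pn; have := memL (Ordinal pn).
  rewrite !mem_points /w_ permE reversal_funE /= => ->.
  by case: ifP; lia.
have := memL (lo L); have := memL (hi L).
have := memL (lo J + hi J - hi K).
have := memL (lo J + hi J - lo K).
by lia.
Qed.

Lemma cactus_pi_rel n u v : @cactus_rel n u v ->
  word_eval (@cactus_pi_gen n) u = word_eval (@cactus_pi_gen n) v.
Proof.
case=> [J|J K dJK|J K L sKJ eL]; rewrite /word_eval !big_cons !big_nil !mulg1 /=.
- by rewrite /cactus_pi_gen; case: ifP; rewrite ?mulg1 ?reversalK.
- rewrite /cactus_pi_gen; case: ifP => //; case: ifP; rewrite ?mulg1 ?mul1g //.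
  have [K0 K1 K2] := cactus_genP K; have [J0 J1 J2] := cactus_genP J.
  move=> lK lJ; apply: reversal_disjoint.
  have a_lt : (maxn (lo J) (lo K)).-1 < n by lia.
  move/pred0P/(_ (Ordinal a_lt)): dJK; rewrite /= !mem_points /=.
  by lia.
- have [JK1 JK2] := points_subset sKJ; have [L1 L2] := points_w sKJ eL.
  have [K0 K1' K2] := cactus_genP K; have [J0 J1' J2] := cactus_genP J.
  rewrite /cactus_pi_gen L1 L2.
  have -> : lo J + hi J - lo K -
    (lo J + hi J - hi K) = hi K - lo K by lia.
  case: (ltnP 1 (hi K - lo K)) => lK; last by rewrite mulg1 mul1g.
  have -> : 1 < hi J - lo J by lia.
  rewrite reversal_nested; [|lia..].
  by congr (reversal _ _ _ * _); lia.
Qed.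

Definition cactus_pi n (g : cactus n) : 'S_n.-1 :=
  pres_lift (@cactus_pi_gen n) g.

HB.instance Definition _ n := isMultiplicative.Build (cactus n) 'S_n.-1
  (@cactus_pi n) (pres_liftM (@cactus_pi_rel n)).

Lemma cactus_pi_c n (J : cactus_gen n) :
  cactus_pi (cactus_c J) = cactus_pi_gen J.
Proof. exact: pres_lift_gen (@cactus_pi_rel n) J. Qed.

Definition is_partition n (la : seq nat) : bool :=
  [&& sorted geq la, 0 \notin la & sumn la == n].

Definition is_hook (la : seq nat) : Prop := exists m l, la = m :: nseq l 1%N.

Section Tableaux.
Variable la : seq nat.

(* Rows and columns are numbered from 0. *)
Definition box :=
  {x : 'I_(size la) * 'I_(head 0 la) | x.2 < nth 0 la x.1}.
HB.instance Definition _ := Finite.on box.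

Definition row (x : box) : nat := (val x).1.
Definition col (x : box) : nat := (val x).2.

(* y is the neighbour of x immediately to the east or to the south *)
Definition next (x y : box) : bool :=
  (row y == row x) && (col y == (col x).+1) ||
  (row y == (row x).+1) && (col y == col x).

Definition filling := {ffun box -> nat}.
HB.instance Definition _ := Countable.on filling.

Definition standard (f : filling) : bool :=
  [&& [forall x, 0 < f x <= sumn la], injectiveb f
    & [forall x, forall y, next x y ==> (f x < f y)]].

Definition syt := {f : filling | standard f}.
HB.instance Definition _ := SubCountable.on syt.

Definition syt_ord (T : syt) : {ffun box -> 'I_(sumn la).+1} :=
  [ffun x => inord (val T x)].

Definition ord_syt (f : {ffun box -> 'I_(sumn la).+1}) : option syt :=
  insub [ffun x => f x : nat].

Lemma syt_ordK : pcancel syt_ord ord_syt.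
Proof.
move=> T; rewrite /ord_syt; suff -> : [ffun x => syt_ord T x : nat] = val T.
  exact: valK.
apply/ffunP => x; rewrite !ffunE inordK //.
by case/and3P: (valP T) => /forallP/(_ x)/andP[_ ?].
Qed.

HB.instance Definition _ : isFinite syt := PCanIsFinite syt_ordK.

(* Sliding inside the part with entries at most k.  The dummy box keeps the
   label 1 while it moves, so that it is always the box labelled 1. *)
Definition slide_move k (f : filling) : option (box * box) :=
  [pick p : box * box |
    [&& f p.1 == 1%N, next p.1 p.2, f p.2 <= k
      & [forall z, next p.1 z && (f z <= k) ==> (f p.2 <= f z)]]].

Definition swap_boxes (f : filling) (p : box * box) : filling :=
  [ffun x => f (tperm p.1 p.2 x)].

Definition slide_step k (f : filling) : filling :=
  if slide_move k f is Some p then swap_boxes f p else f.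

(* The number of iterations exceeds the length of every sliding path. *)
Definition slide k (f : filling) : filling :=
  iter (size la + head 0 la) (slide_step k) f.

Definition promote_filling k (f : filling) : filling :=
  [ffun x => let l := slide k f x in
     if l == 1%N then k else if l <= k then l.-1 else l].

Definition swap_filling k (f : filling) : filling :=
  if [pick p : box * box |
        [&& f p.1 == k, f p.2 == k.+1 & ~~ (next p.1 p.2 || next p.2 p.1)]]
  is Some p then swap_boxes f p else f.

(* By promoteE and bk_swapE below, insubd returns its default here only for
   promote k with k outside [1, n]. *)
Definition promote k (T : syt) : syt := insubd T (promote_filling k (val T)).

Definition bk_swap k (T : syt) : syt := insubd T (swap_filling k (val T)).

(* schutz_init k is xi_[1, k]; the composite is applied from right to left. *)
Fixpoint schutz_init k (T : syt) : syt :=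
  if k is k'.+1 then schutz_init k' (promote k T) else T.

(* The formula for xi_[a, b] also holds for a = 1, where it says that
   xi_[1, b] is an involution. *)
Definition schutz a b (T : syt) : syt :=
  if a == 1%N then schutz_init b T
  else schutz_init b (schutz_init (b - a + 1) (schutz_init b T)).

Definition level (x : box) := row x + col x.

Lemma level_next x y : next x y -> level y = (level x).+1.
Proof. by rewrite /level /next; lia. Qed.

Lemma level_lt x : level x < size la + head 0 la.
Proof.
by rewrite /level /row /col; move: (ltn_ord (val x).1) (ltn_ord (val x).2); lia.
Qed.

Lemma next_neq x y : next x y -> x != y.
Proof. by move=> /level_next lxy; apply/eqP => xy; move: lxy; rewrite xy; lia. Qed.

Lemma standardP (f : filling) : reflect
  [/\ forall x, 0 < f x <= sumn la, injective f
    & forall x y, next x y -> f x < f y] (standard f).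
Proof.
apply: (iffP and3P) => -[fB fI fN]; split.
- by move=> x; exact: (forallP fB).
- exact/injectiveP.
- by move=> x y xy; have /forallP/(_ y)/implyP := forallP fN x; apply.
- by apply/forallP.
- exact/injectiveP.
- by apply/forallP => x; apply/forallP => y; apply/implyP; exact: fN.
Qed.

Definition slide_inv k (f : filling) := [/\ forall x, 0 < f x <= sumn la,
  injective f,
  forall u v, next u v -> f u != 1%N -> f v != 1%N -> f u < f v,
  forall x u v, f x = 1%N -> next u x -> next x v -> f u < f v &
  forall x u, f x = 1%N -> next u x -> f u <= k].

Lemma slide_inv0 k (f : filling) : standard f -> slide_inv k f.
Proof.
case/standardP => fB fI fN; split=> //.
- by move=> u v /fN.
- by move=> x u v x1 /fN; rewrite x1; move: (fB u); lia.
- by move=> x u x1 /fN; rewrite x1; move: (fB u); lia.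
Qed.

Lemma swap_boxesE (f : filling) p x : swap_boxes f p x =
  if x == p.1 then f p.2 else if x == p.2 then f p.1 else f x.
Proof. by rewrite ffunE permE /=; case: ifP => // _; case: ifP. Qed.

Lemma slide_inv_step k (f : filling) : slide_inv k f -> slide_inv k (slide_step k f).
Proof.
move=> inv; rewrite /slide_step /slide_move; case: pickP => // -[x y] /=.
case: inv => fB fI fN fS fk /and4P[/eqP x1 xy yk /forallP ymin].
have Nyx : x == y = false by apply/negbTE/next_neq.
have y1 : f y != 1%N by rewrite -x1 (inj_eq fI) eq_sym Nyx.
have hole z : swap_boxes f (x, y) z = 1%N -> z = y.
  rewrite swap_boxesE /=; case: eqP => [_ /eqP|zx]; first by rewrite (negPf y1).
  by case: eqP => // _; rewrite -x1 => /fI.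
have f1 z : z != x -> f z != 1%N by rewrite -x1 (inj_eq fI).
have yx : y == x = false by rewrite eq_sym.
have fx : swap_boxes f (x, y) x = f y by rewrite swap_boxesE eqxx.
have fy : swap_boxes f (x, y) y = 1%N by rewrite swap_boxesE /= yx eqxx.
have fz z : z != x -> z != y -> swap_boxes f (x, y) z = f z.
  by rewrite swap_boxesE /= => /negPf-> /negPf->.
have toy u : next u y -> u = x \/ [/\ u != x, u != y & f u < f y].
  move=> uy; have uNy := next_neq uy.
  by case: (eqVneq u x) => [|uNx]; [left|right; split=> //; apply: fN => //; apply: f1].
have fromy v : next y v -> [/\ v != x, v != y & f y < f v].
  move=> yv; have vNy : v != y by rewrite eq_sym next_neq.
  have vNx : v != x.
    by apply/eqP => vx; move: (level_next yv) (level_next xy); rewrite vx; lia.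
  by split=> //; apply: fN => //; apply: f1.
have fromx v : next x v -> v != y -> [/\ v != x & f y < f v].
  move=> xv vNy; split; first by rewrite eq_sym next_neq.
  have : f v != f y by rewrite (inj_eq fI).
  by move: (ymin v); rewrite xv /=; case: (leqP (f v) k) => /=; lia.
split.
- by move=> z; rewrite ffunE.
- by move=> u v; rewrite !ffunE => /fI/perm_inj.
- move=> u v uv; case: (eqVneq u y) => [->|uNy]; first by rewrite fy.
  case: (eqVneq v y) => [->|vNy]; first by rewrite fy.
  move=> _ _; case: (eqVneq u x) uv => [->|uNx] uv.
    by have [vNx ?] := fromx _ uv vNy; rewrite fx fz.
  case: (eqVneq v x) uv => [->|vNx] uv; first by rewrite fx fz //; apply: fS xy.
  by rewrite !fz //; apply: fN; rewrite ?f1.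
- move=> z u v /hole -> /toy[->|[uNx uNy uy]] /fromy[vNx vNy yv].
    by rewrite fx fz.
  by rewrite !fz //; lia.
- move=> z u /hole -> /toy[->|[uNx uNy uy]]; first by rewrite fx.
  by rewrite fz //; lia.
Qed.

Lemma slide_inv_iter k (f : filling) t : slide_inv k f -> slide_inv k (iter t (slide_step k) f).
Proof. by move=> inv; elim: t => //= t; exact: slide_inv_step. Qed.

Lemma slide_level k (f : filling) t p : slide_inv k f ->
  slide_move k (iter t (slide_step k) f) = Some p -> t <= level p.1.
Proof.
move=> inv; elim: t p => // t IHt p.
have /= := slide_inv_iter t.+1 inv; have /= := slide_inv_iter t inv.
move: IHt => /=; set g := iter t _ f => IHt [_ gI _ _ _].
rewrite {1 2}/slide_step; case Eg: (slide_move k g) => [q|]; last by rewrite Eg.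
move=> _ Ep; have tq := IHt _ Eg.
move: Eg; rewrite /slide_move; case: pickP => // q' /and4P[/eqP q1 qN _ _] [eq_q].
move: Ep; rewrite /slide_move; case: pickP => // p' /and4P[/eqP p1 _ _ _] [<-].
subst q'; have -> : p'.1 = q.2.
  move: p1; rewrite ffunE -q1 => /gI e.
  by rewrite -(tpermK q.1 q.2 p'.1) e tpermL.
by rewrite (level_next qN).
Qed.

Lemma slide_stuck k (f : filling) : slide_inv k f -> slide_move k (slide k f) = None.
Proof.
move=> inv; case Ep : (slide_move _ _) => [p|] //.
by have := slide_level inv Ep; have := level_lt p.1; lia.
Qed.

Lemma stuckP k (f : filling) x v :
  slide_move k f = None -> f x = 1%N -> next x v -> k < f v.
Proof.
rewrite /slide_move; case: pickP => // none _ x1 xv; rewrite ltnNge; apply/negP => vk.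
pose P z := next x z && (f z <= k).
have Pv : P v by rewrite /P xv.
case: (arg_minnP f Pv) => y /andP[xy yk] ymin.
have /negP[] := negbT (none (x, y)); rewrite /= x1 eqxx xy yk /=.
by apply/forallP => z; apply/implyP => /ymin.
Qed.

Lemma promote_standard k (f : filling) : 0 < k <= sumn la ->
  standard f -> standard (promote_filling k f).
Proof.
move=> kB /(slide_inv0 k) inv0; have stuck := slide_stuck inv0.
have := slide_inv_iter (size la + head 0 la) inv0; rewrite -/(slide k f).
rewrite /promote_filling; move: (slide k f) stuck => g stuck [gB gI gN gS gk].
apply/standardP; split.
- by move=> x; rewrite ffunE /=; move: (gB x); do ?[case: ifP => ?]; lia.
- move=> x y; rewrite !ffunE /= => exy; apply: gI; move: exy (gB x) (gB y).
  by do ?[case: ifP => ?]; lia.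
- move=> x y xy; rewrite !ffunE /=.
  have yk := stuckP stuck _ xy; have xk := gk y x _ xy; have xlty := gN x y xy.
  move: (gB x) (gB y); case: eqP => [x1|x1]; case: eqP => [y1|y1].
  + by move: (next_neq xy); rewrite (gI x y) ?eqxx // x1 y1.
  + by have := yk x1; case: ifP => ?; lia.
  + by have := xk y1; case: ifP => ?; lia.
  + have : g x < g y by apply: xlty; apply/eqP.
    by do ?[case: ifP => ?]; lia.
Qed.

Lemma swap_standard k (f : filling) : standard f -> standard (swap_filling k f).
Proof.
move=> sf; rewrite /swap_filling; case: pickP => // -[x y] /=.
case/standardP: sf => fB fI fN /and3P[/eqP fx /eqP fy /norP[nxy nyx]].
apply/standardP; split.
- by move=> z; rewrite ffunE.
- by move=> u v; rewrite !ffunE => /fI/perm_inj.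
- move=> u v uv; have := fN _ _ uv; rewrite !swap_boxesE /=.
  have ex z : (z == x) = (f z == k) by rewrite -fx (inj_eq fI).
  have ey z : (z == y) = (f z == k.+1) by rewrite -fy (inj_eq fI).
  have : ~~ ((u == x) && (v == y)).
    by apply/negP => /andP[/eqP ux /eqP vy]; rewrite -ux -vy uv in nxy.
  rewrite !ex !ey fx fy.
  by do ?[case: ifP => ?]; lia.
Qed.

Lemma promoteE k (T : syt) : 0 < k <= sumn la ->
  val (promote k T) = promote_filling k (val T).
Proof.
by move=> kB; rewrite val_insubd ifT //; apply: promote_standard (valP T).
Qed.

Lemma bk_swapE k (T : syt) : val (bk_swap k T) = swap_filling k (val T).
Proof. by rewrite val_insubd ifT //; apply: swap_standard (valP T). Qed.

End Tableaux.

Section GL.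
Variables (F : fieldType) (V : vectType F).

Definition GL := {f : 'End(V) | lker f == 0%VS}.
HB.instance Definition _ := SubChoice.on GL.

Definition gl_apply (g : GL) : V -> V := val g.

Lemma gl_one_subproof : lker (\1%VF : 'End(V)) == 0%VS.
Proof. by apply/lker0P => u v; rewrite !lfunE. Qed.

Lemma gl_mul_subproof (g h : GL) : lker (val g \o val h)%VF == 0%VS.
Proof.
apply/lker0P => u v; rewrite !lfunE /=.
by move: (valP g) (valP h) => /lker0P gI /lker0P hI /gI /hI.
Qed.

Lemma gl_inv_subproof (g : GL) : lker ((val g)^-1)%VF == 0%VS.
Proof.
apply/lker0P; apply: can_inj (val g) _ => u.
exact: lker0_lfunVK (valP g) u.
Qed.

Definition gl_one : GL := Sub \1%VF gl_one_subproof.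
Definition gl_mul (g h : GL) : GL := Sub (val g \o val h)%VF (gl_mul_subproof g h).
Definition gl_inv (g : GL) : GL := Sub ((val g)^-1)%VF (gl_inv_subproof g).

Lemma gl_mulA : associative gl_mul.
Proof. by move=> f g h; apply: val_inj; rewrite /= comp_lfunA. Qed.
Lemma gl_mul1g : left_id gl_one gl_mul.
Proof. by move=> f; apply: val_inj; rewrite /= comp_lfun1l. Qed.
Lemma gl_mulg1 : right_id gl_one gl_mul.
Proof. by move=> f; apply: val_inj; rewrite /= comp_lfun1r. Qed.
Lemma gl_mulVg : left_inverse gl_one gl_inv gl_mul.
Proof. by move=> f; apply: val_inj; rewrite /= lker0_compVf ?(valP f). Qed.
Lemma gl_mulgV : right_inverse gl_one gl_inv gl_mul.
Proof. by move=> f; apply: val_inj; rewrite /= lker0_compfV ?(valP f). Qed.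

HB.instance Definition _ := isGroup.Build GL
  gl_mulA gl_mul1g gl_mulg1 gl_mulVg gl_mulgV.

End GL.

Coercion gl_apply : GL >-> Funclass.

Section Representations.
Variables (n : nat) (la : seq nat) (F : fieldType) (V : vectType F).
Variable b : syt la -> V.

(* V stands for the Specht module and b for its Kazhdan-Lusztig basis: the
   construction only uses that b is a basis indexed by standard tableaux, and
   it is made here for any such pair.  A homomorphism rho or eta satisfying
   the condition below is unique, because its values on generators are
   prescribed on a basis. *)
Definition schutzenberger_rep (rho : cactus n -> GL V) : Prop :=
  forall (J : cactus_gen n) (T : syt la),
    rho (cactus_c J) (b T) = b (schutz (lo J) (hi J) T).

(* tperm i j is s_k with k = i.+1, whose image is psi(t_(k+1)). *)
Definition is_eta (eta : 'S_n.-1 -> GL V) : Prop :=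
  forall i j : 'I_n.-1, j = i.+1 :> nat ->
  forall T : syt la, eta (tperm i j) (b T) = b (bk_swap i.+2 T).

End Representations.

(* Main.v *)
From HB Require Import structures.
Require Import Defs.
From mathcomp Require Import all_boot all_order all_fingroup all_algebra zify.
From mathcomp Require Import reals complex.

(* A standard tableau T of hook shape is determined by the set of entries in
   [2, n] lying in its first row.  In these terms everything is a permutation
   of the values 2, ..., n.  The move t_k is the transposition (k k+1) for
   k > 1.  In the promotion of T restricted to [1, k], the dummy box first
   trades places with the entry 2 and then stays in the arm or the leg it
   entered, so promotion is the cyclic shift of [2, k].  Hence xi_[1, k]
   reverses [2, k], and xi_[a, b] reverses [a+1, b], which is w_[a, b-1] after
   relabelling 2, ..., n as 1, ..., n-1.  Both sides of the identity therefore
   agree on the generators of the cactus group. *)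

Set Implicit Arguments.
Unset Strict Implicit.
Unset Printing Implicit Defensive.

(* Importing Defs again makes row and col refer to boxes, not matrices. *)
Import Defs GRing.Theory.

(** * Boxes of a hook and the arm set of a standard filling *)

Section Hook.
Variables m l : nat.
Notation la := (m.+1 :: nseq l 1).
Notation n := (m + l).+1.

Lemma sumn_hook : sumn la = n.
Proof. by rewrite /= sumn_nseq mul1n. Qed.

Lemma box_eq (x y : box la) : row x = row y -> col x = col y -> x = y.
Proof.
rewrite /row /col => /val_inj r /val_inj c; apply: val_inj.
by case: (val x) (val y) r c => [? ?] [? ?] /= -> ->.
Qed.

Lemma hook_boxP (x : box la) : row x = 0 \/ col x = 0.
Proof.
case: x => -[r c] /=; rewrite /row /col /=.
case: (nat_of_ord r) => [|i] /=; first by left.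
by rewrite nth_nseq; case: ifP; right; lia.
Qed.

Lemma hook_box_ex r c : (r == 0) && (c <= m) || (c == 0) && (r <= l) ->
  exists x : box la, row x = r /\ col x = c.
Proof.
move=> rc.
have r_lt : r < size la by rewrite /= size_nseq; lia.
have c_lt : c < head 0 la by rewrite /=; lia.
have rcP : Ordinal c_lt < nth 0 la (Ordinal r_lt).
  move: rc => /=; case: r {r_lt} => [|r] /=; first by lia.
  by rewrite nth_nseq; case: ifP; lia.
by exists (Sub (Ordinal r_lt, Ordinal c_lt) rcP).
Qed.

Lemma hook_pred (x : box la) : (0 < row x) || (0 < col x) ->
  exists y, next y x.
Proof.
move=> x0; have [r c] : row x <= l /\ col x <= m.
  have := ltn_ord (val x).1; have := ltn_ord (val x).2.
  rewrite -/(row x) -/(col x) [size _]/= [head _ _]/= size_nseq.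
  by lia.
case: (hook_boxP x) => e.
  have [|y [yr yc]] := @hook_box_ex 0 (col x).-1; first by lia.
  by exists y; rewrite /next; lia.
have [|y [yr yc]] := @hook_box_ex (row x).-1 0; first by lia.
by exists y; rewrite /next; lia.
Qed.

(** Off the corner, a hook continues only east along the arm or only south along the leg. *)
Lemma hook_next_arm (x y : box la) : next x y -> (0 < row x) || (0 < col x) ->
  (0 < col x) = (0 < col y).
Proof. by rewrite /next; move: (hook_boxP x) (hook_boxP y); lia. Qed.

(** This bound turns an injective filling with values in [[1, n]] into a surjective one. The indices
    up to [m] enumerate the first row, the later ones the leg. *)
Lemma card_hook : n <= #|{: box la}|.
Proof.
pose rc (i : 'I_n) := if i <= m then (0, i : nat) else (i - m, 0).
have rcP i : exists x : box la, (row x == (rc i).1) && (col x == (rc i).2).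
  have [|x [xr xc]] := @hook_box_ex (rc i).1 (rc i).2; last first.
    by exists x; rewrite xr xc !eqxx.
  by rewrite /rc; case: ifP; move: (ltn_ord i) => /=; lia.
have inj : injective (fun i => xchoose (rcP i)).
  move=> i j eij; apply: val_inj; move: (xchooseP (rcP i)) (xchooseP (rcP j)).
  rewrite eij; move: (xchoose _) => x.
  by rewrite /rc; do 2!case: ifP => /=; lia.
by have := leq_card _ inj; rewrite card_ord.
Qed.

Lemma hook_surj (f : filling la) v : standard f -> 0 < v <= n ->
  exists x, f x = v.
Proof.
case/standardP => fB fI _ vn.
have f_lt x : (f x).-1 < n by move: (fB x); rewrite sumn_hook; lia.
pose g x := Ordinal (f_lt x).
have gI : injective g.
  move=> x y /(congr1 val) /= e; apply: fI.
  by move: e (fB x) (fB y); lia.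
have v_lt : v.-1 < n by lia.
have gS : codom g =i predT.
  by apply: inj_card_onto => //; rewrite card_ord card_hook.
have := gS (Ordinal v_lt); rewrite inE => /codomP[x /(congr1 val) /= e].
by exists x; move: (fB x); lia.
Qed.

Lemma hook_corner (f : filling la) x : standard f -> f x = 1 ->
  row x = 0 /\ col x = 0.
Proof.
case/standardP => fB _ fN fx.
case: (posnP (row x + col x)) => [|x0]; first by lia.
have [|y /fN] := @hook_pred x; first by lia.
by rewrite fx; move: (fB y); lia.
Qed.

Lemma hook_off_corner (f : filling la) x : standard f -> 1 < f x ->
  (0 < row x) || (0 < col x).
Proof.
move=> sf fx; have [|y fy] := @hook_surj f 1 sf; first by lia.
have [ry cy] := hook_corner sf fy.
apply: contraLR fx => x0; rewrite (@box_eq x y) ?fy //; lia.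
Qed.

(* In a hook, 0 < col x means that x is in the first row but not the corner. *)
Definition arm (f : filling la) v := [exists x, (0 < col x) && (f x == v)].

Lemma armE (f : filling la) x : injective f -> arm f (f x) = (0 < col x).
Proof.
move=> fI; apply/existsP/idP => [[y /andP[yc /eqP/fI <-]]//|xc].
by exists x; rewrite xc eqxx.
Qed.

(** Descend from [y] box by box: above the level of [x] each predecessor is still off the corner,
    hence in the same arm or leg, and its entry is smaller. *)
Lemma hook_mono (f : filling la) x y : standard f ->
  (0 < row x) || (0 < col x) -> (0 < col x) = (0 < col y) ->
  level x <= level y -> f x <= f y.
Proof.
move=> sf x0; have [_ _ fN] := standardP _ sf.
have [d] := ubnP (level y); elim: d => // d IHd in y *; move=> yd xy lxy.
move: (hook_boxP x) (hook_boxP y); rewrite /level in lxy yd => hx hy.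
case: (ltngtP (row x + col x) (row y + col y)) lxy => // lt_xy _; last first.
  by rewrite (@box_eq x y) //; lia.
have [|z zy] := @hook_pred y; first by lia.
apply: leq_trans (ltnW (fN _ _ zy)).
have lz := level_next zy; rewrite /level in lz.
have z0 : (0 < row z) || (0 < col z) by lia.
by apply: IHd; rewrite /level ?(hook_next_arm zy z0) //; lia.
Qed.

(** Induction on the level. If [g x < f x], let [y] be the box where [f] has the entry [g x]. Equal
    arm sets put [y] in the same arm or leg as [x], so [y] has lower level. There [f] and [g] agree,
    and [g y = g x] contradicts injectivity. *)
Lemma hook_arm_inj (f g : filling la) : standard f -> standard g ->
  (forall v, 1 < v <= n -> arm f v = arm g v) -> f = g.
Proof.
have le (f' g' : filling la) x : standard f' -> standard g' ->
    (forall v, 1 < v <= n -> arm f' v = arm g' v) ->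
    (forall y, level y < level x -> f' y = g' y) -> f' x <= g' x.
  move=> sf sg fg IH; rewrite leqNgt; apply/negP => lt_gf.
  have [fB fI _] := standardP _ sf; have [gB gI _] := standardP _ sg.
  have x0 : (0 < row x) || (0 < col x).
    by apply: (hook_off_corner sf); move: (gB x); lia.
  have gx1 : 1 < g' x.
    rewrite ltn_neqAle; move: (gB x) => /andP[-> _]; rewrite andbT eq_sym.
    by apply/eqP => /(hook_corner sg); lia.
  have gxn : g' x <= n by rewrite -sumn_hook; move: (gB x); lia.
  have [|y fy] := hook_surj sf (v := g' x); first by lia.
  have y0 := hook_off_corner sf; have {}y0 := y0 y; rewrite fy in y0.
  have := fg (g' x); rewrite gx1 gxn -{1}fy !armE // => /(_ isT) exy.
  have lxy : level y < level x.
    rewrite ltnNge; apply/negP => /(hook_mono sf x0 (esym exy)).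
    by rewrite fy; lia.
  by have := IH y lxy; rewrite fy => /gI yx; rewrite yx ltnn in lxy.
move=> sf sg fg; apply/ffunP => x.
have [d] := ubnP (level x); elim: d => // d IHd in x *; move=> xd.
have IH y : level y < level x -> f y = g y by move=> yx; apply: IHd; lia.
apply/eqP; rewrite eqn_leq !le // => [v vn|y yx]; first by rewrite fg.
by rewrite IH.
Qed.

(** * Arm sets under slides, promotion, Schützenberger involutions and the swaps *)

Lemma arm_swap_boxes (f : filling la) x y v :
  injective f -> arm (swap_boxes f (x, y)) v = arm f (
    if v == f x then f y else if v == f y then f x else v).
Proof.
move=> fI; apply: eq_existsb => z; congr (_ && _); rewrite swap_boxesE /=.
rewrite -(inj_eq fI z x) -(inj_eq fI z y).
by do ![case: eqP => //]; congruence.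
Qed.

Lemma arm_slide_step k (f : filling la) :
  injective f -> (forall x, f x = 1 -> (0 < row x) || (0 < col x)) ->
  [/\ injective (slide_step k f),
     forall x, slide_step k f x = 1 -> (0 < row x) || (0 < col x)
   & arm (slide_step k f) =1 arm f].
Proof.
move=> fI f1; rewrite /slide_step /slide_move; case: pickP => //= -[x y] /=.
case/and4P => /eqP fx xy _ _; split.
- by move=> u v; rewrite !ffunE => /fI/perm_inj.
- move=> z; rewrite swap_boxesE /=; case: eqP => [->|_].
    move=> fy; have yx : y = x by apply: fI; rewrite fx.
    by move: (level_next xy); rewrite yx; lia.
  by case: eqP => [-> _|_ /f1 //]; move: (level_next xy); rewrite /level; lia.
- move=> v; rewrite arm_swap_boxes //; case: eqP => [->|_].
    by rewrite !armE // (hook_next_arm xy) // f1.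
  by case: eqP => // ->; rewrite !armE // (hook_next_arm xy) // f1.
Qed.

(* Once the dummy box has left the corner it stays in the arm or in the leg, so
   only the first step of a slide matters. *)
Lemma arm_slide k (f : filling la) v : standard f -> 1 < k <= n -> v != 2 ->
  arm (slide k f) v = arm f (if v == 1 then 2 else v).
Proof.
move=> sf kn v2; have [fB fI fN] := standardP _ sf.
have [|x fx] := @hook_surj f 1 sf; first by lia.
have [|y fy] := @hook_surj f 2 sf; first by lia.
(* The predecessor of the box with entry 2 has a smaller entry, so it is the corner [x]. Hence the
   first step exchanges 1 and 2. *)
have [|z zy] := @hook_pred y; first by apply: (hook_off_corner sf); rewrite fy.
have xy : next x y.
  by rewrite (fI x z) // fx; move: (fN _ _ zy) (fB z); rewrite fy; lia.
have step1 : slide_step k f = swap_boxes f (x, y).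
  rewrite /slide_step /slide_move; case: pickP => [[u w]|/(_ (x, y))] /=.
    case/and4P => /eqP fu uw wk /forallP wmin.
    have eu : u = x by apply: fI; rewrite fu fx.
    subst u; suff -> : w = y by [].
    apply: fI; move: (wmin y) (fN _ _ uw); rewrite xy fx fy /=; lia.
  rewrite fx fy eqxx xy /=; case/andP: kn => -> _ /forallP[] u.
  by apply/implyP => /andP[xu _]; move: (fN _ _ xu); rewrite fx.
have [N eN] : exists N, size la + head 0 la = N.+1.
  by exists (size la + m); rewrite addnS.
rewrite /slide eN iterSr step1; set g := swap_boxes _ _.
have gI : injective g by move=> u w; rewrite !ffunE => /fI/perm_inj.
have g1 u : g u = 1 -> (0 < row u) || (0 < col u).
  rewrite swap_boxesE /= fx fy; case: eqP => // ux; case: eqP => [->|_].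
    by move: (level_next xy); rewrite /level; lia.
  by move=> fu; case: ux; apply: fI; rewrite fx.
suff [_ _ ->] : [/\ injective (iter N (slide_step k) g),
    forall u, iter N (slide_step k) g u = 1 -> (0 < row u) || (0 < col u)
    & arm (iter N (slide_step k) g) =1 arm g].
  by rewrite arm_swap_boxes // fx fy (negPf v2).
elim: N {eN} => //= N [hI h1 hg].
by have [? ? e] := arm_slide_step k hI h1; split=> // u; rewrite e hg.
Qed.

Lemma arm_promote k (T : syt la) v : 0 < k <= n -> 1 < v <= n ->
  arm (val (promote k T)) v =
  arm (val T) (if v < k then v.+1 else if v == k then 2 else v).
Proof.
move=> kn vn; rewrite promoteE ?sumn_hook //.
move: (valP T); set f := val T => sf.
have := slide_inv_iter (size la + head 0 la) (slide_inv0 k sf).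
rewrite -/(slide k f) => -[gB _ _ _ _].
have -> : arm (promote_filling k f) v =
    arm (slide k f) (if v < k then v.+1 else if v == k then 1 else v).
  apply: eq_existsb => x; congr (_ && _); rewrite ffunE /=; move: (gB x).
  by do ?[case: ifP => ?]; lia.
case: (ltnP 1 k) => k1.
  rewrite arm_slide; [|by []|lia|by do ?[case: ifP => ?]; lia].
  by congr (arm f _); case: (ltngtP v k) => ? /=; do ?case: ifP; lia.
(* Here [k = 1]: every neighbour of the corner has an entry above 1, so the dummy box cannot
   move. *)
have -> : slide k f = f.
  apply: iter_fix; rewrite /slide_step /slide_move; case: pickP => // -[x y] /=.
  have [_ _ fN] := standardP _ sf.
  by case/and4P => /eqP fx /fN; lia.
by congr (arm f _); do ?[case: ifP => ?]; lia.
Qed.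

(** The cyclic shift of [[2, k+1]] combined with the reversal of [[2, k]] is the reversal of
    [[2, k+1]]. *)
Lemma arm_schutz_init k (T : syt la) v : k <= n -> 1 < v <= n ->
  arm (val (schutz_init k T)) v = arm (val T) (if v <= k then k.+2 - v else v).
Proof.
elim: k T => [|k IHk] T kn vn /=; first by case: ifP => //; lia.
rewrite IHk; [|lia|by []]; rewrite arm_promote; [|lia|by case: ifP; lia].
by congr (arm _ _); case: (leqP v k) => ?; do ?[case: ifP => ?]; lia.
Qed.

(** Conjugation by the reversal of [[2, b]] carries [[2, b-a+1]] to [[a+1, b]]. *)
Lemma arm_schutz a b (T : syt la) v : 0 < a < b -> b <= n -> 1 < v <= n ->
  arm (val (schutz a b T)) v =
  arm (val T) (if a < v <= b then (a + b).+1 - v else v).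
Proof.
move=> ab bn vn; rewrite /schutz; case: eqP => [->|a1].
  by rewrite arm_schutz_init //; congr (arm _ _); do ?[case: ifP => ?]; lia.
rewrite !arm_schutz_init;
  try by case: (leqP v b) => ?; do ?[case: ifP => ?]; lia.
congr (arm _ _); case: (leqP v b) => ?.
  by case: (leqP (b.+2 - v) (b - a + 1)) => ?; do ?[case: ifP => ?]; lia.
by case: (leqP v (b - a + 1)) => ?; do ?[case: ifP => ?]; lia.
Qed.

(** If the boxes of [k] and [k+1] are adjacent, the tableau is unchanged. Since [k > 1], both boxes
    then lie in the arm or both in the leg, so the transposition fixes the arm set too. *)
Lemma arm_bk_swap k (T : syt la) v : 1 < k < n ->
  arm (val (bk_swap k T)) v =
  arm (val T) (if v == k then k.+1 else if v == k.+1 then k else v).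
Proof.
move=> kn; rewrite bk_swapE; move: (valP T); set f := val T => sf.
have [fB fI fN] := standardP _ sf.
rewrite /swap_filling; case: pickP => [[x y] /=|].
  by case/and3P => /eqP fx /eqP fy _; rewrite arm_swap_boxes // fx fy.
have [|x fx] := @hook_surj f k sf; first by lia.
have [|y fy] := @hook_surj f k.+1 sf; first by lia.
move/(_ (x, y)); rewrite /= fx fy !eqxx /= => /negbFE xy.
have x0 := hook_off_corner sf (x := x); have y0 := hook_off_corner sf (x := y).
have exy : arm f k = arm f k.+1.
  rewrite -fy -fx !armE //; case/orP: xy => [xy|yx].
    by apply: hook_next_arm; rewrite // x0 // fx; lia.
  by apply/esym/hook_next_arm; rewrite // y0 // fy; lia.
by case: eqP => [->//|_]; case: eqP => [->//|_].
Qed.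

End Hook.

(** * Induction principles for groups and linear maps permuting a basis *)

Section Groups.
Local Open Scope group_scope.

(** A transposition [(i j)] with [i + 1 < j] is the conjugate of [(i j-1)] by the adjacent
    transposition [(j-1 j)], which is its own inverse. *)
Lemma adjacent_tperm_ind n (P : 'S_n -> Prop) :
  P 1 -> (forall s t, P s -> P t -> P (s * t)) ->
  (forall i j : 'I_n, j = i.+1 :> nat -> P (tperm i j)) ->
  forall s, P s.
Proof.
move=> P1 PM Padj s; have [ts -> _] := prod_tpermP s.
apply: big_ind => // -[i j] _ /=.
wlog ij : i j / i <= j.
  by move=> IH; case: (leqP i j) => [/IH //|/ltnW/IH]; rewrite tpermC.
have [d] := ubnP (j - i); elim: d => // d IHd in i j ij *; move=> dj.
case: (ltnP i.+1 j) => ij1; last first.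
  have [eij|/Padj //] : i = j \/ j = i.+1 :> nat.
    by case: (eqVneq (i : nat) j) => [/val_inj ->|?]; [left|right; lia].
  by rewrite eij tperm1.
have k_lt : j.-1 < n by move: (ltn_ord j); lia.
pose k := Ordinal k_lt.
have jk : j = k.+1 :> nat by rewrite /=; lia.
have -> : tperm i j = (tperm i k) ^ (tperm k j).
  rewrite tpermJ tpermL tpermD //; first by rewrite -val_eqE /=; lia.
  by rewrite -val_eqE /=; lia.
have Pkj : P (tperm k j) by exact: Padj.
have Pik : P (tperm i k) by apply: IHd => /=; lia.
by rewrite conjgE tpermV; apply: (PM _ _ Pkj); apply: PM.
Qed.

Lemma multiplicative1 (G H : groupType) (f : {multiplicative G -> H}) : f 1 = 1.
Proof. by apply: (mulgI (f 1)); rewrite -gmulfM !mulg1. Qed.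

Lemma pres_morphism_eq (X : choiceType) (R : word X -> word X -> Prop)
    (H : groupType) (f g : {multiplicative pres_group R -> H}) :
  (forall x, f (pres_gen R x) = g (pres_gen R x)) -> f =1 g.
Proof.
move=> fg h; rewrite -(pres_class_repr h).
elim: (generic_quotient.repr h) => [|[x s] u IHu].
  by have -> : pres_class R [::] = 1 by []; rewrite !multiplicative1.
have -> : pres_class R ((x, s) :: u) =
    pres_class R [:: (x, s)] * pres_class R u.
  by rewrite -[LHS]/(pres_class R ([:: (x, s)] ++ u)) -pres_mulE.
rewrite !gmulfM IHu; congr (_ * _); case: s; first exact: fg.
have -> : pres_class R [:: (x, false)] = (pres_gen R x)^-1.
  apply: (mulgI (pres_gen R x)); rewrite mulgV.
  apply: etrans (pres_mulE R _ _) _; apply/pres_classP.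
  exact: (PresCancel _ x true).
have fV (k : {multiplicative pres_group R -> H}) y : k y^-1 = (k y)^-1.
  by apply: (mulgI (k y)); rewrite -gmulfM !mulgV multiplicative1.
by rewrite !fV fg.
Qed.

Lemma gl_applyM (F : fieldType) (V : vectType F) (g h : GL V) v :
  gl_apply (g * h) v = gl_apply g (gl_apply h v).
Proof. exact: comp_lfunE. Qed.

Section Basis.
Variables (F : fieldType) (V : vectType F) (I : finType) (b : I -> V).
Hypothesis bB : basis_of fullv (codom b).

Lemma lfun_eq_basis (f g : 'End(V)) : (forall i, f (b i) = g (b i)) -> f = g.
Proof.
move=> fg; apply/lfunP => v.
rewrite (coord_basis (X := in_tuple (codom b)) bB (memvf v)) !linear_sum /=.
apply: eq_bigr => i _; rewrite !linearZ /=; congr (_ *: _)%R.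
by have /codomP[j ->] := mem_nth 0%R (ltn_ord i).
Qed.

Lemma gl_eq_basis (f g : GL V) : (forall i, f (b i) = g (b i)) -> f = g.
Proof. by move=> fg; apply: val_inj; apply: lfun_eq_basis. Qed.

Lemma basis_lfun (s : I -> I) : {f : 'End(V) | forall i, f (b i) = b (s i)}.
Proof.
have [f fP] := linear_of_free (codom b) (codom (b \o s)).
exists (linfun f) => i; rewrite lfunE /=.
have fb := fP (basis_free bB) (etrans (size_codom _) (esym (size_codom _))).
move: fb; rewrite /codom /image_mem -map_comp => /eq_in_map; apply.
exact: mem_enum.
Qed.

(** Linearizes an action on the index set of a basis. The operator of [g^-1] is a left inverse of
    that of [g], so the kernel is trivial. *)
Lemma perm_rep (G : groupType) (act : G -> I -> I) :
  (forall i, act 1 i = i) ->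
  (forall g h i, act (g * h) i = act g (act h i)) ->
  exists eta : {multiplicative G -> GL V},
    forall g i, gl_apply (eta g) (b i) = b (act g i).
Proof.
move=> act1 actM; pose E g := sval (basis_lfun (act g)).
have EP g i : E g (b i) = b (act g i) by exact: (svalP (basis_lfun (act g))).
have EK g v : E g^-1 (E g v) = v.
  suff: (E g^-1%g \o E g)%VF = \1%VF by move=> /lfunP/(_ v); rewrite !lfunE.
  by apply: lfun_eq_basis => i; rewrite !lfunE /= !EP -actM mulVg act1.
have Eker g : lker (E g) == 0%VS by apply/lker0P; exact: can_inj (EK g).
pose eta g : GL V := Sub (E g) (Eker g).
have etaE g i : eta g (b i) = b (act g i) by rewrite /gl_apply SubK EP.
have etaM : {morph eta : g h / g * h}.
  move=> g h; apply: gl_eq_basis => i.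
  by rewrite etaE actM /gl_apply /= lfunE /= !EP.
pose mM := isMultiplicative.Build G (GL V) eta etaM.
pose m : {multiplicative G -> GL V} := HB.pack eta mM.
by exists m.
Qed.

End Basis.

End Groups.

(** * The action of the symmetric group on hook tableaux, and the factorization *)

Section HookAction.
Local Open Scope group_scope.
Variables m l : nat.
Notation la := (m.+1 :: nseq l 1%N).
Notation n := (m + l).+1.

(** The shift by 2 matches the entries [2, ..., n] with the points of ['S_n.-1], whose ordinals
    start at 0. *)
Definition arms (T : syt la) (i : 'I_(m + l)) := arm (val T) i.+2.

Lemma arms_inj (T U : syt la) : arms T =1 arms U -> T = U.
Proof.
move=> TU; apply: val_inj; apply: hook_arm_inj (valP T) (valP U) _ => v vn.
have i_lt : v.-2 < m + l by lia.
have := TU (Ordinal i_lt); rewrite /arms /=.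
by have -> : v.-2.+2 = v by lia.
Qed.

Lemma arms_bk_swap (i j : 'I_(m + l)) (T : syt la) : j = i.+1 :> nat ->
  arms (bk_swap i.+2 T) =1 arms T \o tperm i j.
Proof.
move=> ij k; rewrite /arms /= arm_bk_swap; last by move: (ltn_ord j); lia.
congr (arm _ _); case: tpermP => [->|->|ki kj].
- by rewrite eqxx ij.
- by rewrite ij eqxx; case: eqP; lia.
- have : (k : nat) <> i by move/val_inj.
  have : (k : nat) <> j by move/val_inj.
  by do 2?case: eqP; lia.
Qed.

(** Adjacent transpositions are realized by [bk_swap], and products by composition. The boolean form
    of the condition lets [xchoose] pick the tableau, unique by [arms_inj]. *)
Lemma syt_act_ex (s : 'S_(m + l)) (T : syt la) :
  exists U : syt la, [forall i, arms U i == arms T (s i)].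
Proof.
suff [U TU] : exists U : syt la, arms U =1 arms T \o s.
  by exists U; apply/forallP => i; rewrite TU.
elim/adjacent_tperm_ind: s T => [|s t IHs IHt|i j ij] T.
- by exists T => i; rewrite /= perm1.
- have [U TU] := IHt T; have [W UW] := IHs U.
  by exists W => i; rewrite UW /= TU /= permM.
- by exists (bk_swap i.+2 T); exact: arms_bk_swap.
Qed.

(* A left action, since permutations are multiplied left to right. *)
Definition syt_act s T := xchoose (syt_act_ex s T).

Lemma arms_act s T : arms (syt_act s T) =1 arms T \o s.
Proof. by move=> i; have /forallP/(_ i)/eqP := xchooseP (syt_act_ex s T). Qed.

Lemma syt_act1 T : syt_act 1 T = T.
Proof. by apply: arms_inj => i; rewrite arms_act /= perm1. Qed.

Lemma syt_actM s t T : syt_act (s * t) T = syt_act s (syt_act t T).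
Proof. by apply: arms_inj => i; rewrite !arms_act /= arms_act /= permM. Qed.

Lemma syt_act_tperm (i j : 'I_(m + l)) T : j = i.+1 :> nat ->
  syt_act (tperm i j) T = bk_swap i.+2 T.
Proof.
by move=> ij; apply: arms_inj => k; rewrite arms_act (arms_bk_swap _ ij).
Qed.

Lemma syt_act_schutz (J : cactus_gen n) T :
  syt_act (cactus_pi_gen J) T = schutz (lo J) (hi J) T.
Proof.
have [J0 J1 J2] := cactus_genP J; apply: arms_inj => i; rewrite arms_act /=.
rewrite /arms arm_schutz; [|lia|by []|by move: (ltn_ord i); lia].
rewrite /cactus_pi_gen; congr (arm _ _); case: ifP => J3; last first.
  (* For [b = a + 1] the interval [[a+1, b]] is a single entry, so its reversal is trivial, like the
     value of [cactus_pi_gen]. *)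
  by rewrite perm1; case: ifP; lia.
rewrite permE reversal_funE; move: (ltn_ord i).
by do 2![case: ifP => ?]; lia.
Qed.

Section Representation.
Variables (F : fieldType) (V : vectType F) (b : syt la -> V).
Hypothesis bB : basis_of fullv (codom b).

Lemma is_eta_act (eta : {multiplicative 'S_n.-1 -> GL V}) : is_eta b eta ->
  forall s T, gl_apply (eta s) (b T) = b (syt_act s T).
Proof.
move=> etaP s; elim/adjacent_tperm_ind: s => [|s t IHs IHt|i j ij] T.
- by rewrite multiplicative1 /gl_apply /= lfunE syt_act1.
- by rewrite gmulfM gl_applyM IHt IHs syt_actM.
- by rewrite (syt_act_tperm _ ij); exact: etaP.
Qed.

Lemma schutz_rep_factor (rho : {multiplicative cactus n -> GL V})
    (eta : {multiplicative 'S_n.-1 -> GL V}) :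
  schutzenberger_rep b rho -> is_eta b eta ->
  forall g : cactus n, rho g = eta (cactus_pi g).
Proof.
move=> rhoP etaP.
apply: (@pres_morphism_eq _ _ _ rho (eta \o @cactus_pi n)) => J.
apply: (gl_eq_basis bB) => T.
rewrite -[pres_gen _ _]/(cactus_c J) rhoP /= cactus_pi_c is_eta_act //.
by rewrite syt_act_schutz.
Qed.

Lemma is_eta_ex : exists eta : {multiplicative 'S_n.-1 -> GL V}, is_eta b eta.
Proof.
have [eta etaP] := perm_rep bB syt_act1 syt_actM.
by exists eta => i j ij T; rewrite etaP syt_act_tperm.
Qed.

(** Pulling [eta] back along [cactus_pi] gives the representation, so the cactus relations for the
    involutions on hook tableaux follow from those in ['S_n.-1]. *)
Lemma schutz_rep_ex :
  exists rho : {multiplicative cactus n -> GL V}, schutzenberger_rep b rho.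
Proof.
have [eta etaP] := is_eta_ex; exists (eta \o @cactus_pi n) => J T /=.
by rewrite cactus_pi_c is_eta_act // syt_act_schutz.
Qed.

End Representation.
End HookAction.

Theorem corollary3p17 (R : realType) (n : nat) (la : seq nat)
    (V : vectType R[i]) (b : syt la -> V) :
  2 <= n ->
  is_partition n la -> is_hook la ->
  la <> [:: n] -> la <> nseq n 1 -> la <> [:: 2; 1] ->
  basis_of fullv (codom b) ->
  [/\ exists rho : {multiplicative cactus n -> GL V}, schutzenberger_rep b rho,
      exists eta : {multiplicative 'S_n.-1 -> GL V}, is_eta b eta
    & forall (rho : {multiplicative cactus n -> GL V})
             (eta : {multiplicative 'S_n.-1 -> GL V}),
        schutzenberger_rep b rho -> is_eta b eta ->
        forall g : cactus n, rho g = eta (cactus_pi g)].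
Proof.
move=> _ la_n [m [l def_la]] _ _ _; subst la; case/and3P: la_n => _.
(* A first part 0 is impossible, since a partition has no zero part. *)
case: m b => [|m] b; first by rewrite inE eqxx.
move=> _ /eqP; rewrite sumn_hook => <- bB.
split; [exact: schutz_rep_ex | exact: is_eta_ex | exact: schutz_rep_factor].
Qed.
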